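(* $$\|G(j\omega)\|_{\mathcal{H}_\infty}=\inf\{\xi>\sigma_1(D):\ \text{the operator }\mathcal{L}_\xi\text{ has no eigenvalues on the imaginary axis}\}.$$
   Context: Here $j$ is the imaginary unit, $\sigma_1(\cdot)$ denotes the largest singular value, $A_0,\dots,A_m\in\mathbb{R}^{n\times n}$, $B\in\mathbb{R}^{n\times n_u}$, $C\in\mathbb{R}^{n_y\times n}$, $D\in\mathbb{R}^{n_y\times n_u}$, and $\tau_0,\dots,\tau_m\ge0$ with $\max_{0\le i\le m}\tau_i=1$. The transfer function is $$G(j\omega)=C\Big(j\omega I-A_0-\sum_{i=1}^mA_ie^{-j\omega\tau_i}\Big)^{-1}B+De^{-j\omega\tau_0}.$$ Standing assumption (stability of $G$): all zeros $\lambda\in\mathbb{C}$ of $\det(\lambda I-A_0-\sum_{i=1}^mA_ie^{-\lambda\tau_i})=0$ lie in the open left half plane. Under this condition $\|G(j\omega)\|_{\mathcal{H}_\infty}=\sup_{\omega\ge0}\sigma_1(G(j\omega))$. For $\xi>0$ with $D_\xi=D^TD-\xi^2I$ nonsingular, put $$M_0=\begin{bmatrix}A_0&-BD_\xi^{-1}B^T\\-C^TC+C^TDD_\xi^{-1}D^TC&-A_0^T\end{bmatrix},\ M_i=\begin{bmatrix}A_i&0\\0&0\end{bmatrix},\ M_{-i}=\begin{bmatrix}0&0\\0&-A_i^T\end{bmatrix}\ (1\le i\le m),$$ $$N_1=\begin{bmatrix}0&0\\0&C^TDD_\xi^{-1}B^T\end{bmatrix},\ N_{-1}=\begin{bmatrix}-BD_\xi^{-1}D^TC&0\\0&0\end{bmatrix}.$$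 Let $X=\mathcal{C}([-1,1],\mathbb{C}^{2n})$ be the space of continuous functions. The operator $\mathcal{L}_\xi$ on $X$ has domain $$\mathcal{D}(\mathcal{L}_\xi)=\Big\{\phi\in X:\ \phi'\in X,\ \phi'(0)=M_0\phi(0)+\sum_{i=1}^m(M_i\phi(-\tau_i)+M_{-i}\phi(\tau_i))+N_1\phi(-\tau_0)+N_{-1}\phi(\tau_0)\Big\}$$ and acts by $\mathcal{L}_\xi\phi=\phi'$. An eigenvalue of $\mathcal{L}_\xi$ is a $\lambda\in\mathbb{C}$ such that $\mathcal{L}_\xi u=\lambda u$ for some nonzero $u\in\mathcal{D}(\mathcal{L}_\xi)$. *)

(* Defs.v *)
From HB Require Import structures.
From mathcomp Require Import all_boot all_order all_algebra.
From mathcomp Require Export complex.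
From mathcomp Require Import all_classical all_reals all_analysis.

Set Implicit Arguments.
Unset Strict Implicit.
Unset Printing Implicit Defensive.

Import Order.TTheory GRing.Theory Num.Theory.
Import numFieldNormedType.Exports.

Local Open Scope classical_set_scope.
Local Open Scope ring_scope.
Local Open Scope complex_scope.
Local Open Scope sesquilinear_scope.

(* MathComp-Analysis has no exponential on R[i]:
   e^(a + jb) = e^a (cos b + j sin b). *)
Definition cexp (R : realType) (z : R[i]) : R[i] :=
  (expR (complex.Re z))%:C * (cos (complex.Im z) +i* sin (complex.Im z)).

Definition cmx (R : realType) (p q : nat) (M : 'M[R]_(p, q)) : 'M[R[i]]_(p, q) :=
  map_mx (fun x : R => x%:C) M.

(* For p < q the q x q matrix M^* M has at least q - p additional zero
   eigenvalues; they do not affect the largest singular value. *)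
Definition singular_value (R : realType) (p q : nat) (M : 'M[R[i]]_(p, q))
    (s : R) : Prop :=
  0 <= s /\ eigenvalue (M ^t* *m M) (s ^+ 2)%:C.

(* A finite set, nonempty as soon as 0 < q, so that the supremum is a maximum. *)
Definition sigma1 (R : realType) (p q : nat) (M : 'M[R[i]]_(p, q)) : R :=
  sup [set s | singular_value M s].

(* The family A_0, ..., A_m (and the delays tau_0, ..., tau_m) is indexed by
   'I_m.+1; index i.+1 is [lift ord0 i] with i : 'I_m. *)
Definition charmx (R : realType) (m n : nat) (A : 'I_m.+1 -> 'M[R]_n)
    (tau : 'I_m.+1 -> R) (lam : R[i]) : 'M[R[i]]_n :=
  lam%:M - cmx (A ord0)
  - \sum_(i < m) cexp (- lam * (tau (lift ord0 i))%:C) *: cmx (A (lift ord0 i)).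

Definition transfer (R : realType) (m n nu ny : nat) (A : 'I_m.+1 -> 'M[R]_n)
    (B : 'M[R]_(n, nu)) (C : 'M[R]_(ny, n)) (D : 'M[R]_(ny, nu))
    (tau : 'I_m.+1 -> R) (s : R[i]) : 'M[R[i]]_(ny, nu) :=
  cmx C *m invmx (charmx A tau s) *m cmx B
  + cexp (- s * (tau ord0)%:C) *: cmx D.

Definition stable (R : realType) (m n : nat) (A : 'I_m.+1 -> 'M[R]_n)
    (tau : 'I_m.+1 -> R) : Prop :=
  forall lam : R[i], \det (charmx A tau lam) = 0 -> complex.Re lam < 0.

(* The supremum is taken in the extended reals: it is +oo, and not a default
   value, when the frequency response is unbounded. *)
Definition hinf_norm (R : realType) (m n nu ny : nat) (A : 'I_m.+1 -> 'M[R]_n)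
    (B : 'M[R]_(n, nu)) (C : 'M[R]_(ny, n)) (D : 'M[R]_(ny, nu))
    (tau : 'I_m.+1 -> R) : \bar R :=
  ereal_sup [set (sigma1 (transfer A B C D tau (0 +i* omega)))%:E
            | omega in [set omega : R | 0 <= omega]].

Definition Dxi (R : realType) (nu ny : nat) (D : 'M[R]_(ny, nu)) (xi : R)
    : 'M[R]_nu :=
  D^T *m D - (xi ^+ 2)%:M.

Definition M0 (R : realType) (n nu ny : nat) (A0 : 'M[R]_n)
    (B : 'M[R]_(n, nu)) (C : 'M[R]_(ny, n)) (D : 'M[R]_(ny, nu)) (xi : R)
    : 'M[R]_(n + n) :=
  block_mx A0 (- (B *m invmx (Dxi D xi) *m B^T))
    (- (C^T *m C) + C^T *m D *m invmx (Dxi D xi) *m D^T *m C) (- A0^T).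

Definition Mpos (R : realType) (n : nat) (Ai : 'M[R]_n) : 'M[R]_(n + n) :=
  block_mx Ai 0 0 0.

Definition Mneg (R : realType) (n : nat) (Ai : 'M[R]_n) : 'M[R]_(n + n) :=
  block_mx 0 0 0 (- Ai^T).

Definition Npos (R : realType) (n nu ny : nat)
    (B : 'M[R]_(n, nu)) (C : 'M[R]_(ny, n)) (D : 'M[R]_(ny, nu)) (xi : R)
    : 'M[R]_(n + n) :=
  block_mx 0 0 0 (C^T *m D *m invmx (Dxi D xi) *m B^T).

Definition Nneg (R : realType) (n nu ny : nat)
    (B : 'M[R]_(n, nu)) (C : 'M[R]_(ny, n)) (D : 'M[R]_(ny, nu)) (xi : R)
    : 'M[R]_(n + n) :=
  block_mx (- (B *m invmx (Dxi D xi) *m D^T *m C)) 0 0 0.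

(* An element of C([-1,1], C^k) is represented by a function on R of which only
   the values on [-1,1] matter. The topology on complex numbers is carried by
   the alias R[i]^o. *)
Definition inX (R : realType) (k : nat) (phi : R -> 'cV[R[i]^o]_k) : Prop :=
  {within `[-1, 1]%classic, continuous phi}.

(* psi is the derivative of phi on [-1,1], one-sided at the endpoints. *)
Definition is_deriv_on (R : realType) (k : nat) (phi psi : R -> 'cV[R[i]^o]_k)
    : Prop :=
  forall t : R, -1 <= t <= 1 ->
    ((s - t)^-1)%:C *: (phi s - phi t) @[s --> within `[-1, 1]%classic t^']
      --> psi t.

(* The graph of L_xi: phi is in the domain and L_xi phi = psi. *)
Definition Lxi (R : realType) (m n nu ny : nat) (A : 'I_m.+1 -> 'M[R]_n)
    (B : 'M[R]_(n, nu)) (C : 'M[R]_(ny, n)) (D : 'M[R]_(ny, nu))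
    (tau : 'I_m.+1 -> R) (xi : R) (phi psi : R -> 'cV[R[i]]_(n + n)) : Prop :=
  [/\ inX phi, inX psi, is_deriv_on phi psi &
    psi 0 = cmx (M0 (A ord0) B C D xi) *m phi 0
      + \sum_(i < m) (cmx (Mpos (A (lift ord0 i))) *m phi (- tau (lift ord0 i))
                      + cmx (Mneg (A (lift ord0 i))) *m phi (tau (lift ord0 i)))
      + cmx (Npos B C D xi) *m phi (- tau ord0)
      + cmx (Nneg B C D xi) *m phi (tau ord0)].

Definition Lxi_eigenvalue (R : realType) (m n nu ny : nat)
    (A : 'I_m.+1 -> 'M[R]_n) (B : 'M[R]_(n, nu)) (C : 'M[R]_(ny, n))
    (D : 'M[R]_(ny, nu)) (tau : 'I_m.+1 -> R) (xi : R) (lam : R[i]) : Prop :=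
  exists u : R -> 'cV[R[i]]_(n + n),
    (exists2 t : R, -1 <= t <= 1 & u t != 0)
    /\ Lxi A B C D tau xi u (fun t => lam *: u t).

(* Main.v *)
(* For xi > sigma_1(D) and real w, jw is an eigenvalue of L_xi if and only if
   xi is a singular value of G(jw): eigenfunctions for jw are e^(jwt) v with
   jw v = H v, and eliminating u from G^* G u = xi^2 u, through the states
   x = (jwI - ...)^-1 B u and z = (jwI - ...)^-* C^T G u, gives H (x, z) = jw (x, z).
   Since w |-> sigma_1(G(jw)) is continuous and, up to the delay factor of modulus one
   on D, G(jw) tends to D at infinity, a level xi > sigma_1(D) that is not attained
   as a singular value of any G(jw) lies above sigma_1(G(jw)) for all w
   (intermediate value theorem); conversely every xi above the H-infinity norm,
   which is at least sigma_1(D), is such a level. *)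
Require Import Defs.
From HB Require Import structures.
From mathcomp Require Import all_boot all_order all_algebra.
From mathcomp Require Import all_classical all_reals all_analysis.
From mathcomp Require Import ring lra.

Set Implicit Arguments.
Unset Strict Implicit.
Unset Printing Implicit Defensive.

Import Order.TTheory GRing.Theory Num.Theory.
Import numFieldNormedType.Exports.

Local Open Scope classical_set_scope.
Local Open Scope ring_scope.
Local Open Scope complex_scope.
Local Open Scope sesquilinear_scope.

Local Notation normc := ComplexField.Normc.normc.

(** * Entrywise norm *)

Section normc_theory.
Variable R : realType.
Implicit Types (x y : R[i]) (a b : R).

Lemma normcCE x : (normc x)%:C = `|x|.
Proof. by rewrite normc_def; case: x. Qed.

Lemma normc_ge0 x : 0 <= normc x.
Proof. by rewrite -ler0c normcCE. Qed.

Lemma normcD x y : normc (x + y) <= normc x + normc y.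
Proof. by rewrite -lecR rmorphD /= !normcCE ler_normD. Qed.

Lemma normc_sum (I : finType) (F : I -> R[i]) :
  normc (\sum_i F i) <= \sum_i normc (F i).
Proof.
elim/big_ind2: _ => //; first by rewrite ComplexField.Normc.normc0.
by move=> x a y b xa yb; rewrite (le_trans (normcD _ _)) ?lerD.
Qed.

Lemma normc_conj x : normc (Num.conj x) = normc x.
Proof. by case: x => a b /=; rewrite sqrrN. Qed.

Lemma normc_real a : normc a%:C = `|a|.
Proof. by rewrite /= expr0n addr0 sqrtr_sqr. Qed.

Lemma normc_Re x : `|complex.Re x| <= normc x.
Proof. by case: x => a b /=; rewrite -sqrtr_sqr ler_wsqrtr// lerDl sqr_ge0. Qed.

Lemma normc_Im x : `|complex.Im x| <= normc x.
Proof. by case: x => a b /=; rewrite -sqrtr_sqr ler_wsqrtr// lerDr sqr_ge0. Qed.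

Lemma normc_le x : normc x <= `|complex.Re x| + `|complex.Im x|.
Proof.
case: x => a b /=; rewrite -[leRHS]ger0_norm ?addr_ge0// -sqrtr_sqr ler_wsqrtr//.
rewrite -(real_normK (num_real a)) -(real_normK (num_real b)).
have := normr_ge0 a; have := normr_ge0 b; nra.
Qed.

End normc_theory.

Section entrywise_norm.
Variable R : realType.

(** The estimates below only need a norm that is submultiplicative and invariant under the adjoint;
    this one satisfies both by manipulation of finite sums. *)
Definition mxsum (p q : nat) (M : 'M[R[i]]_(p, q)) : R :=
  \sum_i \sum_j normc (M i j).

Lemma mxsum_ge0 p q (M : 'M[R[i]]_(p, q)) : 0 <= mxsum M.
Proof. by do 2!apply: sumr_ge0 => ? _; exact: normc_ge0. Qed.

Lemma mxsumD p q (M N : 'M[R[i]]_(p, q)) : mxsum (M + N) <= mxsum M + mxsum N.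
Proof.
rewrite /mxsum -big_split ler_sum// => i _; rewrite -big_split ler_sum// => j _.
by rewrite mxE normcD.
Qed.

Lemma mxsumN p q (M : 'M[R[i]]_(p, q)) : mxsum (- M) = mxsum M.
Proof. by do 2!apply: eq_bigr => ? _; rewrite mxE normcN. Qed.

Lemma mxsum0 p q : mxsum (0 : 'M[R[i]]_(p, q)) = 0.
Proof.
rewrite /mxsum big1 // => i _; rewrite big1 // => j _.
by rewrite mxE ComplexField.Normc.normc0.
Qed.

Lemma mxsum_sum (I : finType) p q (F : I -> 'M[R[i]]_(p, q)) :
  mxsum (\sum_i F i) <= \sum_i mxsum (F i).
Proof.
elim/big_ind2: _ => //; first by rewrite mxsum0.
by move=> x a y b xa yb; rewrite (le_trans (mxsumD _ _)) ?lerD.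
Qed.

Lemma mxsumZ p q a (M : 'M[R[i]]_(p, q)) : mxsum (a *: M) = normc a * mxsum M.
Proof.
rewrite /mxsum mulr_sumr; apply: eq_bigr => i _; rewrite mulr_sumr.
by apply: eq_bigr => j _; rewrite mxE ComplexField.Normc.normcM.
Qed.

(** Expanding the right-hand side gives the products [normc (M i j) * normc (N j' k)] for all pairs
    [j], [j']; the diagonal ones [j = j'] already bound the left-hand side. *)
Lemma mxsumM p q r (M : 'M[R[i]]_(p, q)) (N : 'M[R[i]]_(q, r)) :
  mxsum (M *m N) <= mxsum M * mxsum N.
Proof.
rewrite /mxsum mulr_suml ler_sum// => i _.
apply: (@le_trans _ _ (\sum_k \sum_j normc (M i j) * normc (N j k))).
  apply: ler_sum => k _; rewrite mxE (le_trans (normc_sum _))// ler_sum// => j _.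
  by rewrite ComplexField.Normc.normcM.
rewrite exchange_big/= mulr_suml ler_sum// => j _; rewrite -mulr_sumr.
rewrite ler_wpM2l ?normc_ge0// [leRHS](bigD1 j)//= lerDl.
by do 2!apply: sumr_ge0 => ? _; exact: normc_ge0.
Qed.

Lemma mxsum_adjoint p q (M : 'M[R[i]]_(p, q)) : mxsum (M ^t*) = mxsum M.
Proof.
rewrite /mxsum exchange_big/=; apply: eq_bigr => i _; apply: eq_bigr => j _.
by rewrite !mxE normc_conj.
Qed.

Lemma mxsum1 p : mxsum (1%:M : 'M[R[i]]_p) = p%:R.
Proof.
rewrite /mxsum -[RHS](mulr1n p%:R) -[in RHS](card_ord p) -sum1_card natr_sum.
rewrite mulr1n; apply: eq_bigr => i _; rewrite (bigD1 i)//= big1 ?addr0.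
  by rewrite mxE eqxx normc_real normr1.
by move=> j ji; rewrite mxE eq_sym (negPf ji) ComplexField.Normc.normc0.
Qed.

End entrywise_norm.

(** * Largest singular value *)

Section largest_singular_value.
Variable R : realType.

Lemma sum_normc_sqE p (v : 'rV[R[i]]_p) :
  (v *m v ^t*) 0 0 = (\sum_i normc (v 0 i) ^+ 2)%:C.
Proof.
rewrite mxE rmorph_sum; apply: eq_bigr => i _; rewrite !mxE -normCK.
by rewrite rmorphXn /= normcCE.
Qed.

(** Row vectors are used because [eigenvalue] refers to left eigenvectors. The Rayleigh quotient of
    the Gram matrix is thus a quotient of squared lengths, hence real and nonnegative. *)
Lemma gram_normE p q (M : 'M[R[i]]_(p, q)) (v : 'rV[R[i]]_q) :
  (v *m (M ^t* *m M) *m v ^t*) 0 0 =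
  (\sum_i normc ((v *m M ^t*) 0 i) ^+ 2)%:C.
Proof.
by rewrite -sum_normc_sqE trmx_mul map_mxM trmxCK !mulmxA.
Qed.

Lemma sum_normc_sq_gt0 p (v : 'rV[R[i]]_p) :
  v != 0 -> 0 < \sum_i normc (v 0 i) ^+ 2.
Proof.
move=> /dotmx_is_dotmx; rewrite dotmxE sum_normc_sqE.
by rewrite -ltcR.
Qed.

Lemma gram_hermitian p q (M : 'M[R[i]]_(p, q)) : M ^t* *m M \is hermsymmx.
Proof.
by apply/is_hermitianmxP; rewrite expr0 scale1r trmx_mul map_mxM trmxCK.
Qed.

(* The maximum of the Rayleigh quotient, attained on an eigenvector by the
   spectral theorem. *)
Lemma sigma1P p q (M : 'M[R[i]]_(p, q)) : (0 < q)%N ->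
  singular_value M (sigma1 M) /\
  forall v : 'rV_q, \sum_i normc ((v *m M ^t*) 0 i) ^+ 2 <=
    sigma1 M ^+ 2 * \sum_i normc (v 0 i) ^+ 2.
Proof.
case: q M => // q M _; set H := M ^t* *m M.
have Hh := gram_hermitian M.
have Hr := hermitian_spectral_diag_real Hh.
have /orthomx_spectralP HE := hermitian_normalmx Hh.
set P := spectralmx _ in HE; set sp := spectral_diag _ in HE Hr.
have Pu : P \is unitarymx by exact: spectral_unitarymx.
have Pi : P \in unitmx by exact: spectral_unit.
pose e i := complex.Re (sp 0 i).
have spE i : sp 0 i = (e i)%:C.
  by rewrite RRe_real//; exact: (mxOverP Hr).
(* The rows of the unitary matrix [P] are orthonormal eigenvectors, so row [k] belongs to the
   largest eigenvalue [e k]. *)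
pose k := [arg max_(i > ord0) e i]%O.
have kP i : e i <= e k by rewrite /k; case: arg_maxP => // j _ /(_ i); apply.
have eigk : eigenvalue H (e k)%:C.
  apply/eigenvalueP; exists (row k P); last first.
    apply/eqP => r0; have := row_unitarymxP Pu k k.
    rewrite r0 dotmxE mul0mx mxE eqxx => /eqP.
    by rewrite eq_sym oner_eq0.
  rewrite /H HE -!row_mul !mulmxA mulmxV// mul1mx -/P row_mul.
  by rewrite row_diag_mx -scalemxAl -rowE spE.
have ray (v : 'rV_q.+1) : \sum_i normc ((v *m M ^t*) 0 i) ^+ 2 <=
    e k * \sum_i normc (v 0 i) ^+ 2.
  rewrite -lecR rmorphM /= -gram_normE -sum_normc_sqE HE invmx_unitary//.
  (* In the coordinates [v *m P^t*] the quadratic form is diagonal, and each coefficient [e i] is at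
     most [e k]. *)
  have vw : v = v *m P^t* *m P.
    by rewrite -mulmxA -(invmx_unitary Pu) mulVmx ?mulmx1.
  have -> : v *m (P ^t* *m diag_mx sp *m P) *m v ^t* =
      (v *m P^t*) *m diag_mx sp *m (v *m P ^t*)^t*.
    by rewrite trmx_mul map_mxM trmxCK !mulmxA.
  have -> : (v *m v^t*) = (v *m P^t*) *m (v *m P ^t*)^t*.
    by rewrite trmx_mul map_mxM trmxCK !mulmxA -vw.
  set w := v *m P^t*; rewrite mul_mx_diag [leLHS]mxE [X in _ * X]mxE mulr_sumr.
  apply: ler_sum => i _; rewrite !mxE spE mulrAC mulrC -normCK -!normcCE -rmorphXn /=.
  rewrite -!rmorphM /= lecR ler_wpM2r ?kP//.
  by rewrite exprn_ge0// normc_ge0.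
have ek0 : 0 <= e k.
  have /eigenvalueP[v Hv v0] := eigk.
  have := gram_normE M v; rewrite -/H Hv -scalemxAl mxE sum_normc_sqE -rmorphM /=.
  move=> /complexI h; have : 0 <= e k * \sum_i normc (v 0 i) ^+ 2.
    by rewrite h; apply: sumr_ge0 => i _; rewrite exprn_ge0// normc_ge0.
  by rewrite pmulr_lge0// sum_normc_sq_gt0.
have sk : singular_value M (Num.sqrt (e k)).
  by split; [exact: sqrtr_ge0 | rewrite sqr_sqrtr; [exact: eigk | exact: ek0]].
(* An eigenvector for [s ^+ 2] has Rayleigh quotient [s ^+ 2], which is at most [e k]; the supremum
   is therefore attained at the square root of [e k]. *)
have ub : ubound [set s | singular_value M s] (Num.sqrt (e k)).
  move=> s [s0 /eigenvalueP[v Hv v0]].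
  have := gram_normE M v; rewrite -/H Hv -scalemxAl mxE sum_normc_sqE -rmorphM /=.
  move=> /complexI h; have := ray v; rewrite -h ler_pM2r ?sum_normc_sq_gt0//.
  by move=> h2; rewrite -(ger0_norm s0) -sqrtr_sqr ler_wsqrtr.
have -> : sigma1 M = Num.sqrt (e k).
  apply/eqP; rewrite eq_le; apply/andP; split.
    by apply: ge_sup => //; exists (Num.sqrt (e k)).
  by apply: ub_le_sup => //; exists (Num.sqrt (e k)).
by split=> // v; rewrite sqr_sqrtr.
Qed.

End largest_singular_value.

(** * Perturbation of the largest singular value *)

Section sigma1_perturbation.
Variable R : realType.

(** Each product [normc (v 0 i) * normc (v 0 j)] is at most the squared length of [v], by the
    inequality 2ab <= a^2 + b^2. *)
Lemma normc_quadratic_form p (E : 'M[R[i]]_p) (v : 'rV_p) :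
  normc ((v *m E *m v ^t*) 0 0) <= mxsum E * \sum_i normc (v 0 i) ^+ 2.
Proof.
set V := \sum_i _.
have vV i : normc (v 0 i) ^+ 2 <= V.
  by rewrite /V (bigD1 i)//= lerDl; apply: sumr_ge0 => j _; exact: sqr_ge0.
rewrite mxE (le_trans (normc_sum _))// /mxsum exchange_big/= mulr_suml.
apply: ler_sum => j _; rewrite ComplexField.Normc.normcM [X in normc X]mxE.
rewrite (le_trans (ler_wpM2r (normc_ge0 _) (normc_sum _)))// !mulr_suml.
apply: ler_sum => i _; rewrite !mxE ComplexField.Normc.normcM normc_conj.
rewrite mulrAC mulrC ler_wpM2l ?normc_ge0//.
have := vV i; have := vV j; have := sqr_ge0 (normc (v 0 i) - normc (v 0 j)).
by rewrite sqrrB; lra.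
Qed.

Lemma singular_value_gramE p q (M : 'M[R[i]]_(p, q)) s : singular_value M s ->
  exists2 v : 'rV_q, v != 0 &
    \sum_i normc ((v *m M ^t*) 0 i) ^+ 2 = s ^+ 2 * \sum_i normc (v 0 i) ^+ 2.
Proof.
move=> [s0 /eigenvalueP[v Hv v0]]; exists v => //.
apply: complexI; rewrite -gram_normE Hv -scalemxAl mxE sum_normc_sqE.
by rewrite [RHS]rmorphM.
Qed.

Lemma singular_value_le_sigma1 p q (M : 'M[R[i]]_(p, q)) s : (0 < q)%N ->
  singular_value M s -> s <= sigma1 M.
Proof.
move=> q0 Ms; have [[s10 _] /(_ _) ray] := sigma1P M q0.
have [v v0 vs] := singular_value_gramE Ms.
have := ray v; rewrite vs ler_pM2r ?sum_normc_sq_gt0//.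
by case: Ms => s0 _; rewrite ler_pXn2r.
Qed.

(** A vector realizing [sigma1 M] is tested in the Rayleigh bound for [N]. The error is the
    quadratic form of the difference of the Gram matrices, which factors through [M - N]. *)
Lemma sigma1_sq_le p q (M N : 'M[R[i]]_(p, q)) : (0 < q)%N ->
  sigma1 M ^+ 2 <= sigma1 N ^+ 2 + mxsum (M - N) * (mxsum M + mxsum N).
Proof.
move=> q0; have [/singular_value_gramE[v v0 vM] _] := sigma1P M q0.
have [_ /(_ v) vN] := sigma1P N q0.
have V0 := sum_normc_sq_gt0 v0.
rewrite -(ler_pM2r V0) -vM mulrDl -lerBlDl.
set E := M^t* *m M - N^t* *m N.
apply: (@le_trans _ _ (mxsum E * \sum_i normc (v 0 i) ^+ 2)).
  apply: le_trans (normc_quadratic_form _ _).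
  apply: le_trans (normc_Re _); apply: le_trans (ler_norm _).
  rewrite /E mulmxBr mulmxBl mxE [X in complex.Re (_ + X)]mxE !gram_normE -rmorphB /=.
  by rewrite lerB.
rewrite ler_wpM2r ?(ltW V0)//.
have -> : E = (M - N)^t* *m M + N^t* *m (M - N).
  rewrite linearB /= map_mxB mulmxBl mulmxBr /E.
  by rewrite addrA subrK.
rewrite (le_trans (mxsumD _ _))// mulrDr lerD//.
  by rewrite (le_trans (mxsumM _ _))// mxsum_adjoint.
by rewrite (le_trans (mxsumM _ _))// mxsum_adjoint mulrC.
Qed.

(** The bound involves only [M - N] and [N], so it is uniform in [M] near a fixed [N]. *)
Lemma sigma1_sq_dist p q (M N : 'M[R[i]]_(p, q)) : (0 < q)%N ->
  `|sigma1 M ^+ 2 - sigma1 N ^+ 2| <=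
    mxsum (M - N) * (mxsum (M - N) + 2 * mxsum N).
Proof.
move=> q0.
have MN : mxsum M <= mxsum (M - N) + mxsum N.
  by rewrite -[in leLHS](subrK N M) mxsumD.
have := sigma1_sq_le M N q0; have := sigma1_sq_le N M q0.
rewrite -[mxsum (N - M)]mxsumN opprB => h1 h2.
have {}MN : mxsum (M - N) * (mxsum M + mxsum N) <=
    mxsum (M - N) * (mxsum (M - N) + 2 * mxsum N).
  rewrite ler_wpM2l ?mxsum_ge0// (le_trans (lerD MN (lexx _)))//.
  by rewrite -addrA lerD2l mulr_natl mulr2n.
rewrite ler_distl lerBlDr; apply/andP; split.
  by rewrite (le_trans h1)// lerD2l [mxsum N + _]addrC.
by rewrite (le_trans h2)// lerD2l.
Qed.

End sigma1_perturbation.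

(** * Frequency response *)

Section frequency_response.
Variable R : realType.

Lemma locally_lipschitz_continuous (f : R -> R) (x K d : R) : 0 < d ->
  (forall y, `|y - x| < d -> `|f y - f x| <= K * `|y - x|) ->
  {for x, continuous f}.
Proof.
move=> d0 fK; apply/cvgrPdist_lt => e e0.
(* The sign of [K] is not prescribed; [|K| + 1] is positive and dominates it. *)
have K0 : 0 < `|K| + 1 by rewrite ltr_wpDl.
have : \forall y \near x, `|x - y| < Num.min d (e / (`|K| + 1)).
  by apply: (@nbhsx_ballx _ R x); rewrite lt_min d0 divr_gt0.
move=> H; apply: filterS H => y; rewrite lt_min distrC => /andP[yd ye].
rewrite distrC (le_lt_trans (fK _ yd))//.
rewrite ltr_pdivlMr// in ye; rewrite (le_lt_trans _ ye)// mulrC ler_wpM2l//.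
by rewrite (le_trans (ler_norm _))// lerDl.
Qed.

Lemma MVT_dist_le (f df : R -> R) :
  (forall x : R, is_derive x (1 : R) f (df x)) -> (forall x, `|df x| <= 1) ->
  forall a b, `|f a - f b| <= `|a - b|.
Proof.
move=> fdf df1 a b; wlog ab : a b / a <= b.
  by move=> H; have [|/ltW] := leP a b => /H //; rewrite distrC [in leRHS]distrC.
have [|c _ fab] := @MVT_segment R f df a b ab (fun x _ => fdf x).
  apply: derivable_within_continuous => x _.
  exact: (@ex_derive _ _ _ _ _ _ _ (fdf x)).
by rewrite distrC fab normrM [leRHS]distrC ler_piMl.
Qed.

Lemma cos_dist_le (a b : R) : `|cos a - cos b| <= `|a - b|.
Proof.
apply: (@MVT_dist_le cos (fun x => - sin x)) => x.
by rewrite normrN sin_max.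
Qed.

Lemma sin_dist_le (a b : R) : `|sin a - sin b| <= `|a - b|.
Proof.
apply: (@MVT_dist_le sin cos) => x.
by rewrite cos_max.
Qed.

Lemma cexp_imag (w t : R) :
  cexp (- (0 +i* w) * t%:C) = cos (w * t) -i* sin (w * t).
Proof.
rewrite /cexp; simpc => /=.
by rewrite expR0 cosN sinN; simpc.
Qed.

Lemma normc_cexp_imag (w t : R) : normc (cexp (- (0 +i* w) * t%:C)) = 1.
Proof. by rewrite cexp_imag /= sqrrN cos2Dsin2 sqrtr1. Qed.

(** The factor 2 comes from bounding the modulus by the sum of the real and imaginary parts, as
    cosine and sine are each 1-Lipschitz. *)
Lemma cexp_imag_dist (w w' t : R) :
  normc (cexp (- (0 +i* w) * t%:C) - cexp (- (0 +i* w') * t%:C)) <=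
  2 * `|t| * `|w - w'|.
Proof.
rewrite !cexp_imag (le_trans (normc_le _))//=.
have -> : 2 * `|t| * `|w - w'| = `|w * t - w' * t| + `|w * t - w' * t|.
  by rewrite -mulrBl normrM; ring.
rewrite lerD ?cos_dist_le//.
by rewrite -opprD normrN sin_dist_le.
Qed.

Lemma mxsum_scalar p (a : R[i]) : mxsum (a%:M : 'M[R[i]]_p) = normc a * p%:R.
Proof. by rewrite -scalemx1 mxsumZ mxsum1. Qed.

Section system.
Variables (m n : nat) (A : 'I_m.+1 -> 'M[R]_n) (tau : 'I_m.+1 -> R).
Hypothesis stableG : stable A tau.

Let Delta w := charmx A tau (0 +i* w).

(** A zero of the determinant at jw would have real part 0, against stability. *)
Lemma charmx_unit w : Delta w \in unitmx.
Proof.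
rewrite unitmxE unitfE; apply/eqP => /stableG /=.
by rewrite ltxx.
Qed.

Lemma charmx_lipschitz :
  exists2 L, 0 <= L & forall w w', mxsum (Delta w - Delta w') <= L * `|w - w'|.
Proof.
exists (n%:R + \sum_(i < m) 2 * `|tau (lift ord0 i)| * mxsum (cmx (A (lift ord0 i)))).
  rewrite addr_ge0// sumr_ge0// => i _; exact: mulr_ge0 (mulr_ge0 _ _) (mxsum_ge0 _).
move=> w w'.
have -> : Delta w - Delta w' = (0 +i* (w - w'))%:M -
    \sum_(i < m) (cexp (- (0 +i* w) * (tau (lift ord0 i))%:C) -
      cexp (- (0 +i* w') * (tau (lift ord0 i))%:C)) *: cmx (A (lift ord0 i)).
  have -> : 0 +i* (w - w') = 0 +i* w - 0 +i* w' :> R[i].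
    by simpc.
  rewrite (eq_bigr _ (fun i _ => scalerBl _ _ _)) sumrB /= /Delta /charmx.
  rewrite !opprD !opprK addrACA [X in X + _]addrACA addNr addr0.
  by rewrite -raddfB.
rewrite (le_trans (mxsumD _ _))// mulrDl lerD//.
  by rewrite mxsum_scalar mulrC /= expr0n /= add0r sqrtr_sqr.
rewrite mxsumN (le_trans (mxsum_sum _))// mulr_suml ler_sum// => i _.
by rewrite mxsumZ mulrAC ler_wpM2r ?mxsum_ge0// cexp_imag_dist.
Qed.

End system.
End frequency_response.

(** * Continuity and high-frequency behaviour of the transfer function *)

Section transfer_function.
Variable R : realType.
Variables (m n nu ny : nat) (A : 'I_m.+1 -> 'M[R]_n).
Variables (B : 'M[R]_(n, nu)) (C : 'M[R]_(ny, n)) (D : 'M[R]_(ny, nu)).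
Variable tau : 'I_m.+1 -> R.
Hypothesis nu_gt0 : (0 < nu)%N.
Hypothesis stableG : stable A tau.

Let Delta w := charmx A tau (0 +i* w).
Let G w := transfer A B C D tau (0 +i* w).

(** The resolvent identity Y - X = Y (Delta w - Delta w') X is used twice: first to bound Y near
    [w], then to turn that bound into a Lipschitz estimate. *)
Lemma resolvent_lipschitz w : exists K d, [/\ 0 <= K, 0 < d &
  forall w', `|w' - w| < d ->
    mxsum (invmx (Delta w') - invmx (Delta w)) <= K * `|w' - w|].
Proof.
have [L L0 HL] := charmx_lipschitz A tau.
set X := invmx (Delta w).
have [s s0 Xs] : exists2 s, 0 < s & mxsum X <= s.
  by exists (mxsum X + 1); [rewrite ltr_wpDl ?mxsum_ge0 | rewrite lerDl].
have Ls1 : 0 < L * s + 1 by rewrite ltr_wpDl ?mulr_ge0 ?(ltW s0).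
(* This radius forces L e s <= 1/2. Then |Y| <= |Y - X| + |X| <= |Y|/2 + s, so |Y| <= 2s, and the
   identity yields the constant 2s L s. *)
exists (2 * s * L * s), (2 * (L * s + 1))^-1; split.
- by rewrite !mulr_ge0 ?(ltW s0).
- by rewrite invr_gt0 mulr_gt0.
move=> w' ww'; set Y := invmx (Delta w'); set e := `|w' - w|.
have e0 : 0 <= e by exact: normr_ge0.
have YX : Y - X = Y *m (Delta w - Delta w') *m X.
  rewrite mulmxBr mulVmx ?charmx_unit// mulmxBl mul1mx -mulmxA mulmxV ?charmx_unit//.
  by rewrite mulmx1.
have SYX : mxsum (Y - X) <= mxsum Y * (L * e * s).
  rewrite YX (le_trans (mxsumM _ _))//.
  rewrite mulrA ler_pM ?mxsum_ge0// (le_trans (mxsumM _ _))//.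
  by rewrite ler_wpM2l ?mxsum_ge0// /e distrC HL.
have Les : L * e * s <= 2^-1.
  rewrite mulrAC; move: ww'; rewrite -/e invfM => ww'.
  rewrite (le_trans (ler_wpM2l _ (ltW ww')))// ?mulr_ge0 ?(ltW s0)//.
  by rewrite mulrCA ler_piMr// ler_pdivrMr// mul1r lerDl.
have SY : mxsum Y <= 2 * s.
  have : mxsum Y <= mxsum (Y - X) + mxsum X.
    by rewrite -[in leLHS](subrK X Y) mxsumD.
  have : mxsum Y * (L * e * s) <= mxsum Y * 2^-1.
    by rewrite ler_wpM2l ?mxsum_ge0.
  move: SYX Xs; move: (mxsum Y) (mxsum (Y - X)) (mxsum X) => y z x; lra.
rewrite (le_trans SYX)//.
have -> : 2 * s * L * s * e = 2 * s * (L * e * s) by ring.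
by rewrite ler_wpM2r// !mulr_ge0 ?(ltW s0).
Qed.

(** With X the resolvent at jw, jw X = I + E X, where E gathers the [A] matrices with factors of
    modulus one and has norm at most K. Hence w|X| <= n + K|X|, the norm of the identity being n. *)
Lemma resolvent_decay : exists2 K, 0 <= K &
  forall w, K < w -> mxsum (invmx (Delta w)) <= n%:R / (w - K).
Proof.
exists (\sum_i mxsum (cmx (A i))); first by rewrite sumr_ge0// => i _; exact: mxsum_ge0.
set K := \sum_i _ => w Kw; set X := invmx _.
have w0 : 0 < w.
  by rewrite (le_lt_trans _ Kw)// sumr_ge0// => i _; exact: mxsum_ge0.
rewrite ler_pdivlMr ?subr_gt0// mulrBr lerBlDr.
set E := cmx (A ord0) + \sum_(i < m)
  cexp (- (0 +i* w) * (tau (lift ord0 i))%:C) *: cmx (A (lift ord0 i)).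
have XE : (0 +i* w) *: X = 1%:M + E *m X.
  rewrite -[X in X + _](mulmxV (charmx_unit stableG w)) -/(Delta w) -/X -mulmxDl.
  by rewrite /Delta /charmx -[X in X + E]addrA -opprD subrK mul_scalar_mx.
have -> : mxsum X * w = mxsum ((0 +i* w) *: X).
  by rewrite mxsumZ mulrC /= expr0n /= add0r sqrtr_sqr gtr0_norm.
rewrite XE (le_trans (mxsumD _ _))// mxsum1 lerD2l (le_trans (mxsumM _ _))//.
rewrite mulrC ler_wpM2l ?mxsum_ge0// /E /K big_ord_recl.
rewrite (le_trans (mxsumD _ _))// lerD2l (le_trans (mxsum_sum _))// ler_sum// => i _.
by rewrite mxsumZ normc_cexp_imag mul1r.
Qed.

Lemma transfer_lipschitz w : exists K d, [/\ 0 <= K, 0 < d &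
  forall w', `|w' - w| < d -> mxsum (G w' - G w) <= K * `|w' - w|].
Proof.
have [K [d [K0 d0 Kd]]] := resolvent_lipschitz w.
exists (mxsum (cmx C) * K * mxsum (cmx B) + 2 * `|tau ord0| * mxsum (cmx D)), d.
split=> // [|w' /Kd Xw].
  by rewrite addr_ge0// !mulr_ge0 ?mxsum_ge0.
have -> : G w' - G w =
    cmx C *m (invmx (Delta w') - invmx (Delta w)) *m cmx B +
    (cexp (- (0 +i* w') * (tau ord0)%:C) -
     cexp (- (0 +i* w) * (tau ord0)%:C)) *: cmx D.
  by rewrite mulmxBr mulmxBl scalerBl addrACA -opprD.
rewrite (le_trans (mxsumD _ _))// mulrDl lerD//.
  rewrite (le_trans (mxsumM _ _))// [leRHS]mulrAC ler_wpM2r ?mxsum_ge0//.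
  by rewrite (le_trans (mxsumM _ _))// -mulrA ler_wpM2l ?mxsum_ge0.
by rewrite mxsumZ [leRHS]mulrAC ler_wpM2r ?mxsum_ge0// cexp_imag_dist.
Qed.

Lemma sigma1_sq_transfer_continuous :
  continuous (fun w => sigma1 (G w) ^+ 2).
Proof.
move=> w; have [K [d [K0 d0 Kd]]] := transfer_lipschitz w.
(* Restricting to distance below 1 bounds the increment of [G] by [K], which makes the quadratic
   estimate of [sigma1_sq_dist] linear. *)
apply: (@locally_lipschitz_continuous _ _ _ (K * (K + 2 * mxsum (G w))) (Num.min d 1)).
  by rewrite lt_min d0 ltr01.
move=> w'; rewrite lt_min => /andP[/Kd Gw w1].
rewrite (le_trans (sigma1_sq_dist _ _ nu_gt0))// mulrAC.
rewrite ler_pM ?mxsum_ge0 ?addr_ge0 ?mulr_ge0 ?mxsum_ge0//.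
rewrite lerD2r (le_trans Gw)// ler_piMr// ltW//.
Qed.

(** The delay factor has modulus one and cancels in the Gram matrix. *)
Lemma sigma1_feedthrough w :
  sigma1 (cexp (- (0 +i* w) * (tau ord0)%:C) *: cmx D) = sigma1 (cmx D).
Proof.
set d := cexp _; have dd : Num.conj d * d = 1.
  by rewrite mulrC -normCK -normcCE normc_cexp_imag expr1n.
have gramE : (d *: cmx D)^t* *m (d *: cmx D) = (cmx D)^t* *m cmx D.
  have -> : (d *: cmx D)^t* = Num.conj d *: (cmx D)^t*.
    by apply/matrixP => i j; rewrite !mxE rmorphM.
  by rewrite -scalemxAl -scalemxAr scalerA dd scale1r.
by rewrite /sigma1 /singular_value gramE.
Qed.

(** Apart from the delayed feedthrough, [G] is a resolvent term that decays at high frequency. One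
    frequency for each tolerance [e] is enough for the level argument further down. *)
Lemma sigma1_sq_transfer_infinity e : 0 < e ->
  exists2 w, 0 <= w & `|sigma1 (G w) ^+ 2 - sigma1 (cmx D) ^+ 2| <= e.
Proof.
move=> e0; have [K K0 HK] := resolvent_decay.
set c := mxsum (cmx C) * n%:R * mxsum (cmx B).
have c0 : 0 <= c by rewrite !mulr_ge0 ?mxsum_ge0.
set b := c + 2 * mxsum (cmx D).
have b0 : 0 <= b by rewrite addr_ge0// mulr_ge0// mxsum_ge0.
(* At w = K + t the resolvent term is at most c/t, which is at most c since t >= 1; the total error
   is then at most (c/t) b, and t >= cb/e brings it below e. *)
pose t := 1 + c * b / e.
have t1 : 1 <= t.
  by rewrite /t lerDl; apply: divr_ge0 (ltW e0); exact: mulr_ge0.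
have t0 : 0 < t by rewrite (lt_le_trans ltr01).
exists (K + t); first by rewrite addr_ge0// ltW.
set w := K + t; rewrite -(sigma1_feedthrough w).
set dD := _ *: cmx D.
have GD : mxsum (G w - dD) <= c / t.
  rewrite /G /transfer addrK (le_trans (mxsumM _ _))// /c [leRHS]mulrAC.
  rewrite ler_wpM2r ?mxsum_ge0// (le_trans (mxsumM _ _))// -mulrA.
  rewrite ler_wpM2l ?mxsum_ge0// (le_trans (HK _ _))// ?ltrDl//.
  by rewrite /w addrAC subrr add0r.
rewrite (le_trans (sigma1_sq_dist _ _ nu_gt0))//.
have -> : mxsum dD = mxsum (cmx D) by rewrite mxsumZ normc_cexp_imag mul1r.
rewrite (@le_trans _ _ (c / t * b))//.
  rewrite ler_pM ?mxsum_ge0 ?addr_ge0 ?mulr_ge0 ?mxsum_ge0// lerD2r (le_trans GD)//.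
  by rewrite ler_pdivrMr// ler_peMr.
rewrite mulrAC ler_pdivrMr// /t [e * _]mulrDr mulr1 [e * _]mulrCA divff ?gt_eqF// mulr1.
by rewrite lerDr ltW.
Qed.

End transfer_function.

(** * Hamiltonian matrix *)

Section cmx_theory.
Variable R : realType.

Lemma cmxE p q (M : 'M[R]_(p, q)) : cmx M = map_mx (real_complex R) M.
Proof. by []. Qed.

Lemma cmxM p q r (M : 'M[R]_(p, q)) (N : 'M[R]_(q, r)) :
  cmx (M *m N) = cmx M *m cmx N.
Proof. exact: map_mxM. Qed.

Lemma cmxD p q (M N : 'M[R]_(p, q)) : cmx (M + N) = cmx M + cmx N.
Proof. by rewrite !cmxE map_mxD. Qed.

Lemma cmxN p q (M : 'M[R]_(p, q)) : cmx (- M) = - cmx M.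
Proof. by rewrite !cmxE map_mxN. Qed.

Lemma cmx0 p q : cmx (0 : 'M[R]_(p, q)) = 0.
Proof. by rewrite cmxE map_mx0. Qed.

Lemma cmxV p (M : 'M[R]_p) : cmx (invmx M) = invmx (cmx M).
Proof. by rewrite !cmxE map_invmx. Qed.

Lemma cmx_block p q r s (M1 : 'M[R]_(p, r)) (M2 : 'M[R]_(p, s)) (M3 : 'M[R]_(q, r))
    (M4 : 'M[R]_(q, s)) :
  cmx (block_mx M1 M2 M3 M4) = block_mx (cmx M1) (cmx M2) (cmx M3) (cmx M4).
Proof. by rewrite !cmxE map_block_mx. Qed.

Lemma cmx_adjoint p q (M : 'M[R]_(p, q)) : (cmx M)^t* = cmx M^T.
Proof. by apply/matrixP => i j; rewrite !mxE conj_Creal// complex_real. Qed.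

Lemma adjointM p q r (M : 'M[R[i]]_(p, q)) (N : 'M[R[i]]_(q, r)) :
  (M *m N)^t* = N^t* *m M^t*.
Proof. by rewrite trmx_mul map_mxM. Qed.

Lemma adjointD p q (M N : 'M[R[i]]_(p, q)) : (M + N)^t* = M^t* + N^t*.
Proof. by apply/matrixP => i j; rewrite !mxE rmorphD. Qed.

Lemma adjointZ p q a (M : 'M[R[i]]_(p, q)) : (a *: M)^t* = Num.conj a *: M^t*.
Proof. by apply/matrixP => i j; rewrite !mxE rmorphM. Qed.

(** Taking adjoints exchanges left and right eigenvectors of the Hermitian Gram matrix; [a] is real
    and so fixed by conjugation. The state equations need column vectors. *)
Lemma gram_eigenvalueP p q (M : 'M[R[i]]_(p, q)) (a : R) :
  eigenvalue (M^t* *m M) a%:C <->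
  exists2 u : 'cV_q, u != 0 & M^t* *m (M *m u) = a%:C *: u.
Proof.
have aC : Num.conj (a%:C : R[i]) = a%:C by rewrite conj_Creal// complex_real.
have adj0 r s (N : 'M[R[i]]_(r, s)) : N != 0 -> N^t* != 0.
  by apply: contra_neq => N0; rewrite -(trmxCK N) N0 trmx0 map_mx0.
split=> [/eigenvalueP[v Mv v0]|[u u0 Mu]].
  exists (v^t*); first exact: adj0.
  have := congr1 (fun N => N^t*) Mv.
  by rewrite !adjointM trmxCK adjointZ aC -mulmxA.
apply/eigenvalueP; exists (u^t*); last exact: adj0.
have := congr1 (fun N => N^t*) Mu.
by rewrite !adjointM trmxCK adjointZ aC -mulmxA.
Qed.

End cmx_theory.

(* Writing x = X^-1 B u and z = Y^-1 C' G u, where X is the characteristic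
   matrix and Y its adjoint, the relation G^* G u = s u becomes
   W u = - (B' z + d' D' C x), which is solved for u. *)
Lemma gram_hamiltonian (F : fieldType) (n nu ny : nat) (X Y : 'M[F]_n)
    (B : 'M[F]_(n, nu)) (C : 'M[F]_(ny, n)) (D : 'M[F]_(ny, nu))
    (B' : 'M[F]_(nu, n)) (C' : 'M[F]_(n, ny)) (D' : 'M[F]_(nu, ny))
    (d d' s : F) (W := D' *m D - s%:M) :
    X \in unitmx -> Y \in unitmx -> W \in unitmx -> d' * d = 1 ->
  (exists2 u : 'cV_nu, u != 0 &
    (B' *m invmx Y *m C' + d' *: D') *m
      ((C *m invmx X *m B + d *: D) *m u) = s *: u) <->
  (exists x z : 'cV_n, [/\ (x != 0) || (z != 0),
    X *m x = - (B *m (invmx W *m (B' *m z + d' *: (D' *m (C *m x))))) &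
    Y *m z = C' *m (C *m x) -
      d *: (C' *m (D *m (invmx W *m (B' *m z + d' *: (D' *m (C *m x))))))]).
Proof.
move=> Xu Yu Wu dd; set G := C *m _ *m B + _.
have Wuu (u : 'cV_nu) : W *m u = D' *m (D *m u) - s *: u.
  by rewrite mulmxBl mul_scalar_mx mulmxA.
split=> [[u u0 Gu]|[x [z [xz0 Xx Yz]]]].
  pose x := invmx X *m (B *m u); pose z := invmx Y *m (C' *m (G *m u)).
  have GuE : G *m u = C *m x + d *: (D *m u).
    by rewrite /G mulmxDl -!mulmxA -scalemxAl.
  (* Here [d' * d = 1] removes the delay from the product of [D'] and [D], leaving exactly [W]. *)
  have WuE : B' *m z + d' *: (D' *m (C *m x)) = - (W *m u).
    rewrite Wuu opprB -Gu mulmxDl -scalemxAl -!mulmxA -/z -addrA.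
    congr (_ + _); rewrite GuE mulmxDr scalerDr -scalemxAr scalerA dd scale1r.
    by rewrite addrK.
  have uE : invmx W *m (B' *m z + d' *: (D' *m (C *m x))) = - u.
    by rewrite WuE mulmxN mulKmx.
  exists x, z; split.
  - apply: contra_neqT u0; rewrite negb_or !negbK => /andP[/eqP x0 /eqP z0].
    move: uE; rewrite x0 z0 !mulmx0 scaler0 addr0 mulmx0 => /esym/eqP.
    by rewrite oppr_eq0 => /eqP.
  - by rewrite uE mulmxN opprK mulKVmx.
  - by rewrite uE !mulmxN scalerN opprK mulKVmx// GuE mulmxDr -scalemxAr.
(* Conversely, [u] is read off from the states. Since [X] and [Y] are invertible, [x] and [z] are
   then driven by [u], so [u = 0] would make both vanish. *)
set u := - (invmx W *m (B' *m z + d' *: (D' *m (C *m x)))).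
have uE : invmx W *m (B' *m z + d' *: (D' *m (C *m x))) = - u by rewrite opprK.
clearbody u.
rewrite uE mulmxN opprK in Xx; rewrite uE !mulmxN scalerN opprK in Yz.
have xE : x = invmx X *m (B *m u) by rewrite -Xx mulKmx.
have GuE : G *m u = C *m x + d *: (D *m u).
  by rewrite /G mulmxDl -!mulmxA -scalemxAl xE.
have zE : z = invmx Y *m (C' *m (G *m u)).
  by rewrite GuE mulmxDr -scalemxAr -Yz mulKmx.
have WuE : B' *m z + d' *: (D' *m (C *m x)) = - (W *m u).
  by rewrite -mulmxN -uE mulKVmx.
exists u.
  apply: contraTneq xz0 => u0.
  by rewrite zE GuE xE u0 !mulmx0 scaler0 addr0 !mulmx0 eqxx.
rewrite mulmxDl -!mulmxA -zE -scalemxAl GuE mulmxDr -scalemxAr scalerDr scalerA.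
by rewrite dd scale1r addrA WuE Wuu opprB subrK.
Qed.

(** * The Hamiltonian matrix at an imaginary frequency and the singular values of G *)

Section hamiltonian.
Variable R : realType.

Definition cis (x : R) : R[i] := cos x +i* sin x.

Lemma cexp_cis (w t : R) : cexp (- (0 +i* w) * t%:C) = cis (w * - t).
Proof. by rewrite cexp_imag /cis mulrN cosN sinN. Qed.

Lemma conj_cis x : Num.conj (cis x) = cis (- x).
Proof. by rewrite /cis cosN sinN. Qed.

Lemma cisN_mul x : cis (- x) * cis x = 1.
Proof.
rewrite /cis cosN sinN; apply/eqP; rewrite eq_complex /=.
by rewrite !mulNr opprK -!expr2 cos2Dsin2 [sin x * _]mulrC subrr !eqxx.
Qed.

Lemma sum_block_diag_mx (V : nmodType) (I : finType) p q
    (a : I -> 'M[V]_p) (b : I -> 'M[V]_q) :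
  \sum_i block_mx (a i) 0 0 (b i) = block_mx (\sum_i a i) 0 0 (\sum_i b i).
Proof.
elim/big_rec3: _ => [|i x y z _ ->]; last by rewrite add_block_mx !addr0.
by rewrite block_mx0.
Qed.

Variables (m n nu ny : nat) (A : 'I_m.+1 -> 'M[R]_n).
Variables (B : 'M[R]_(n, nu)) (C : 'M[R]_(ny, n)) (D : 'M[R]_(ny, nu)).
Variables (tau : 'I_m.+1 -> R) (xi : R).

(* The right-hand side of the domain condition of L_xi at phi(t) = e^(jwt) v
   is hamiltonian w *m v. *)
Definition hamiltonian (w : R) : 'M[R[i]]_(n + n) :=
  cmx (M0 (A ord0) B C D xi)
  + \sum_(i < m) (cis (w * - tau (lift ord0 i)) *: cmx (Mpos (A (lift ord0 i)))
                + cis (w * tau (lift ord0 i)) *: cmx (Mneg (A (lift ord0 i))))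
  + cis (w * - tau ord0) *: cmx (Npos B C D xi)
  + cis (w * tau ord0) *: cmx (Nneg B C D xi).

Let b := cmx B.
Let c := cmx C.
Let d := cmx D.
Let b' := cmx B^T.
Let c' := cmx C^T.
Let d' := cmx D^T.
Let W := invmx (cmx (Dxi D xi)).

Lemma hamiltonianE w : hamiltonian w = block_mx
  (cmx (A ord0)
    + \sum_(i < m) cis (w * - tau (lift ord0 i)) *: cmx (A (lift ord0 i))
    - cis (w * tau ord0) *: (b *m W *m d' *m c))
  (- (b *m W *m b'))
  (- (c' *m c) + c' *m d *m W *m d' *m c)
  (- cmx (A ord0)^T
    - \sum_(i < m) cis (w * tau (lift ord0 i)) *: cmx (A (lift ord0 i))^T
    + cis (w * - tau ord0) *: (c' *m d *m W *m b')).
Proof.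
rewrite /hamiltonian.
under eq_bigr => i _.
  rewrite /Mpos /Mneg !cmx_block !cmx0 !scale_block_mx !scaler0.
  rewrite add_block_mx !addr0 add0r cmxN scalerN.
  over.
rewrite sum_block_diag_mx sumrN /M0 /Npos /Nneg !cmx_block !cmx0.
rewrite !scale_block_mx !scaler0 !add_block_mx !addr0.
have e12 : cmx (B *m invmx (Dxi D xi) *m B^T) = b *m W *m b'.
  by rewrite 2!cmxM cmxV.
have e11 : cmx (B *m invmx (Dxi D xi) *m D^T *m C) = b *m W *m d' *m c.
  by rewrite 3!cmxM cmxV.
have e21 : cmx (C^T *m D *m invmx (Dxi D xi) *m D^T *m C) = c' *m d *m W *m d' *m c.
  by rewrite 4!cmxM cmxV.
have e22 : cmx (C^T *m D *m invmx (Dxi D xi) *m B^T) = c' *m d *m W *m b'.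
  by rewrite 3!cmxM cmxV.
by rewrite cmxD !cmxN e11 e12 e21 e22 cmxM scalerN.
Qed.

Lemma charmx_imag w : charmx A tau (0 +i* w) = (0 +i* w)%:M - cmx (A ord0)
  - \sum_(i < m) cis (w * - tau (lift ord0 i)) *: cmx (A (lift ord0 i)).
Proof. by rewrite /charmx; under eq_bigr do rewrite cexp_cis. Qed.

(** The data are real, so the adjoint transposes them, and conjugation turns every delay into an
    advance. This is the source of the terms at [+ tau i] with [- A_i^T] in the domain condition. *)
Lemma charmx_imag_adjoint w : (charmx A tau (0 +i* w))^t* =
  - (0 +i* w)%:M - cmx (A ord0)^T
  - \sum_(i < m) cis (w * tau (lift ord0 i)) *: cmx (A (lift ord0 i))^T.
Proof.
rewrite charmx_imag; apply/matrixP => i j; rewrite !mxE !rmorphB /= !summxE.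
rewrite rmorph_sum /=; congr (_ - _ - _).
- rewrite eq_sym; case: (i == j); rewrite ?mulr1n ?mulr0n ?rmorph0 ?oppr0//.
  by apply/eqP; rewrite eq_complex /= oppr0 !eqxx.
- by rewrite conj_Creal// complex_real.
- apply: eq_bigr => k _; rewrite -[LHS]/(Num.conj _) !mxE rmorphM /=.
  rewrite conj_cis mulrN opprK.
  by rewrite conj_Creal// complex_real.
Qed.


(** Splitting [v] into [x] and [z], the two block rows become the two equations of
    [gram_hamiltonian], with the characteristic matrix and its adjoint as [X] and [Y]. *)
Lemma hamiltonian_eigenP w (stableG : stable A tau)
    (Dxi_unit : Dxi D xi \in unitmx) :
  (exists2 v : 'cV_(n + n), v != 0 & (0 +i* w) *: v = hamiltonian w *m v) <->
  eigenvalue ((transfer A B C D tau (0 +i* w))^t* *m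
              transfer A B C D tau (0 +i* w)) (xi ^+ 2)%:C.
Proof.
set G := transfer _ _ _ _ _ _; set X := charmx A tau (0 +i* w).
have Xu : X \in unitmx by exact: charmx_unit.
have Yu : X^t* \in unitmx by rewrite map_unitmx unitmx_tr.
have WE : cmx (Dxi D xi) = d' *m d - (xi ^+ 2)%:C%:M.
  by rewrite /Dxi cmxE map_mxB map_mxM map_scalar_mx.
have Wu : d' *m d - (xi ^+ 2)%:C%:M \in unitmx by rewrite -WE map_unitmx.
have GE : G = c *m invmx X *m b + cis (w * - tau ord0) *: d.
  by rewrite /G /transfer cexp_cis.
have GaE : G^t* = b' *m invmx (X^t*) *m c' + cis (w * tau ord0) *: d'.
  rewrite GE adjointD adjointZ conj_cis mulrN opprK !adjointM !cmx_adjoint.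
  by rewrite trmx_inv map_invmx mulmxA.
have dd : cis (w * tau ord0) * cis (w * - tau ord0) = 1.
  by rewrite mulrN mulrC cisN_mul.
clearbody G.
apply: (iff_trans _ (iff_sym (gram_eigenvalueP _ _))).
rewrite GaE.
rewrite GE.
apply: (iff_trans _ (iff_sym (@gram_hamiltonian _ n nu ny _ _ b c d
  b' c' d' _ _ _ Xu Yu Wu dd))).
rewrite -WE -/W.
(* Each block row of [hamiltonian w *m col_mx x z] is jw times its component plus or minus the
   residual of one state equation, so the eigenvector relation says that both residuals vanish. *)
have key x z : (0 +i* w) *: col_mx x z = hamiltonian w *m col_mx x z <->
   (X *m x = - (b *m (W *m (b' *m z + cis (w * tau ord0) *: (d' *m (c *m x))))) /\
   X^t* *m z = c' *m (c *m x) - cis (w * - tau ord0) *: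
     (c' *m (d *m (W *m (b' *m z + cis (w * tau ord0) *: (d' *m (c *m x))))))).
  rewrite hamiltonianE mul_block_col scale_col_mx.
  set u := W *m (_ + _).
  have -> : (cmx (A ord0)
      + \sum_(i < m) cis (w * - tau (lift ord0 i)) *: cmx (A (lift ord0 i))
      - cis (w * tau ord0) *: (b *m W *m d' *m c)) *m x + - (b *m W *m b') *m z
    = (0 +i* w) *: x - (X *m x + b *m u).
    rewrite /X charmx_imag /u !mulmxDl !mulNmx mul_scalar_mx !mulmxDr.
    rewrite -!scalemxAl -!scalemxAr !mulmxA.
    move: (cmx (A ord0) *m x) ((\sum_(i < m) _) *m x)
      (_ *: (b *m W *m d' *m c *m x)) (b *m W *m b' *m z) ((0 +i* w) *: x).
    by move=> x1 x2 x3 x4 x5; apply/matrixP => k l; rewrite !mxE; ring.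
  have -> : (- (c' *m c) + c' *m d *m W *m d' *m c) *m x + (- cmx (A ord0)^T
      - \sum_(i < m) cis (w * tau (lift ord0 i)) *: cmx (A (lift ord0 i))^T
      + cis (w * - tau ord0) *: (c' *m d *m W *m b')) *m z
    = (0 +i* w) *: z + (X^t* *m z - (c' *m (c *m x) - cis (w * - tau ord0) *:
     (c' *m (d *m u)))).
    rewrite /X charmx_imag_adjoint /u !mulmxDl !mulNmx mul_scalar_mx.
    rewrite !mulmxDr -!scalemxAl -!scalemxAr !mulmxA.
    (* The delay and the advance cancel here, which is why the lower left block carries no
       exponential. *)
    rewrite scalerDr scalerA [_ * cis (w * tau ord0)]mulrC dd scale1r.
    move: (cmx (A ord0)^T *m z) ((\sum_(i < m) _) *m z) ((0 +i* w) *: z)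
      (_ *: (c' *m d *m W *m b' *m z)) (c' *m c *m x) (c' *m d *m W *m d' *m c *m x).
    by move=> x1 x2 x3 x4 x5 x6; apply/matrixP => k l; rewrite !mxE; ring.
  have subE (V : zmodType) (p q r : V) : p = p - (q + r) <-> q = - r.
    split=> [/eqP|->]; last by rewrite addNr subr0.
    by rewrite eq_sym subr_eq addrC -subr_eq subrr eq_sym addr_eq0 => /eqP.
  have addE (V : zmodType) (p q r : V) : p = p + (q - r) <-> q = r.
    split=> [/eqP|->]; last by rewrite subrr addr0.
    by rewrite eq_sym addrC -subr_eq0 addrK subr_eq0 => /eqP.
  split=> [/eq_col_mx[/subE ? /addE ?]//|[/subE <- /addE <-]//].
split=> [[v v0]|[x [z [xz0 Xx Yz]]]].
  rewrite -(vsubmxK v) => /key[Xx Yz]; exists (usubmx v), (dsubmx v); split=> //.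
  by move: v0; rewrite -{1}(vsubmxK v) col_mx_eq0 negb_and.
exists (col_mx x z); last exact/key.
by rewrite col_mx_eq0 negb_and.
Qed.

End hamiltonian.

(** * Eigenfunctions *)

Section complex_vector_limits.
Variable R : realType.

(** Limits of complex vectors are reduced to real limits, so that real differential calculus and the
    mean value theorem apply. *)
Lemma cvg_complex_colP (T : Type) (F : set_system T) (FF : Filter F) k
    (f : T -> 'cV[R[i]^o]_k) (l : 'cV[R[i]^o]_k) :
  f @ F --> l <->
  forall i, (complex.Re (f x i 0) @[x --> F] --> complex.Re (l i 0)) /\
            (complex.Im (f x i 0) @[x --> F] --> complex.Im (l i 0)).
Proof.
split=> [fl i|H].
  have near_normc e : 0 < e -> \forall x \near F, normc (l i 0 - f x i 0) < e.
    move=> e0; have /cvg_ballP/(_ e%:C) := fl.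
    rewrite ltcR => /(_ e0); apply: filterS => x [_ /(_ i 0)].
    by rewrite -ball_normE /= -normcCE ltcR.
  split; apply/cvgrPdist_lt => e e0; apply: filterS (near_normc e e0) => x.
    by apply: le_lt_trans; rewrite -raddfB normc_Re.
  by apply: le_lt_trans; rewrite -raddfB normc_Im.
apply/cvg_ballP => e e0.
(* A radius that is positive in [R[i]] has zero imaginary part. *)
have [eE e'0] : e = (complex.Re e)%:C /\ 0 < complex.Re e.
  by case: e e0 => a b /andP[/eqP /= -> ? ].
have e2 : 0 < complex.Re e / 2 by rewrite divr_gt0.
have : \forall x \near F, forall i, normc (l i 0 - f x i 0) < complex.Re e.
  apply: filter_forall => i.
  have [/cvgrPdist_lt/(_ _ e2) hR /cvgrPdist_lt/(_ _ e2) hI] := H i.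
  apply: filterS2 hR hI => x xR xI.
  rewrite (le_lt_trans (normc_le _))// [ltRHS]splitr.
  by apply: ltrD; rewrite raddfB.
apply: filterS => x xe; split=> // i j; rewrite (ord1 j) -ball_normE /= -normcCE eE.
by rewrite ltcR.
Qed.

(** Carathéodory's criterion: the slope, extended by [l] at [t], is continuous there. *)
Lemma is_derive_slopeP (f : R -> R) (t l : R) :
  is_derive t 1 f l <-> (s - t)^-1 * (f s - f t) @[s --> t^'] --> l.
Proof.
split=> [/is_derive1_caratheodory[g [fg cg <-]]|H].
  apply: cvg_trans (_ : g @ t^' --> g t); last exact/continuous_withinNx.
  apply: near_eq_cvg; near=> s; rewrite fg mulrC mulfK// subr_eq0.
  by near: s; exact: nbhs_dnbhs_neq.
apply/is_derive1_caratheodory.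
exists (fun s => if s == t then l else (s - t)^-1 * (f s - f t)); split.
- move=> z; case: eqP => [->|/eqP zt]; first by rewrite !subrr mulr0.
  by rewrite mulrAC mulVf ?mul1r// subr_eq0.
- apply/continuous_withinNx; rewrite eqxx; apply: cvg_trans H.
  apply: near_eq_cvg; near=> s; rewrite ifN//.
  by near: s; exact: nbhs_dnbhs_neq.
- by rewrite eqxx.
Unshelve. all: by end_near. Qed.

(** At an interior point a limit along the interval is a full two-sided limit, so [is_deriv_on]
    gives an ordinary derivative there. *)
Lemma within_dnbhs_itv (a b t : R) : a < t < b ->
  t^' `=>` within `[a, b]%classic t^'.
Proof.
move=> tab P; rewrite /within /= => tP.
have tI : t \in `]a, b[ by rewrite in_itv.
have : \forall s \near t^', s \in `]a, b[ by apply: nbhs_dnbhs; exact: near_in_itvoo.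
move: tP; apply: filterS2 => s sP sab; apply: sP => /=.
by apply: subset_itv_oo_cc sab.
Qed.

Lemma is_derive_cos_scale (w t : R) :
  is_derive t 1 (fun s => cos (w * s)) (- (w * sin (w * t))).
Proof.
have -> : (fun s => cos (w * s)) = cos \o (w \*: id) by [].
apply: is_derive_eq.
by rewrite /GRing.scale /= mulr1 mulNr mulrC.
Qed.

Lemma is_derive_sin_scale (w t : R) :
  is_derive t 1 (fun s => sin (w * s)) (w * cos (w * t)).
Proof.
have -> : (fun s => sin (w * s)) = sin \o (w \*: id) by [].
apply: is_derive_eq.
by rewrite /GRing.scale /= mulr1 mulrC.
Qed.

(** The hypotheses say that z = a + jb solves z' = jwz, and the combination is the real part of
    e^(-jwt) z(t). Its derivative vanishes inside the interval, and continuity carries constancy to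
    the endpoints. *)
Lemma rotation_constant (w : R) (a b : R -> R) :
  {within `[-1, 1], continuous a} -> {within `[-1, 1], continuous b} ->
  (forall t : R, -1 < t < 1 -> is_derive t 1 a (- (w * b t))) ->
  (forall t : R, -1 < t < 1 -> is_derive t 1 b (w * a t)) ->
  forall t : R, -1 <= t <= 1 -> cos (w * t) * a t + sin (w * t) * b t = a 0.
Proof.
move=> ca cb da db.
pose f := (fun t => cos (w * t)) * a + (fun t => sin (w * t)) * b.
have df (t : R) : t \in `]-1, 1[ -> is_derive t 1 f 0.
  rewrite in_itv /= => t1.
  have dat := da t t1; have dbt := db t t1.
  have dc := is_derive_cos_scale w t; have ds := is_derive_sin_scale w t.
  have H := is_deriveD (is_deriveM dc dat) (is_deriveM ds dbt).
  by apply: (is_derive_eq H); rewrite /GRing.scale /=; ring.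
have cf : {within `[-1, 1], continuous f}.
  move=> x; apply: continuousD; apply: continuousM.
  - apply: continuous_subspaceT => y; apply: differentiable_continuous.
    by apply/derivable1_diffP; case: (is_derive_cos_scale w y).
  - exact: ca.
  - apply: continuous_subspaceT => y; apply: differentiable_continuous.
    by apply/derivable1_diffP; case: (is_derive_sin_scale w y).
  - exact: cb.
have fcst (t : R) : -1 <= t <= 1 -> f t = f (-1).
  move=> /andP[t1 t2]; apply/eqP; rewrite -subr_eq0.
  have dft x : x \in `]-1, t[ -> is_derive x 1 f 0.
    move=> /andP[x1 x2]; apply: df; rewrite in_itv/=; apply/andP; split=> //.
    exact: lt_le_trans x2 t2.
  have cft : {within `[-1, t], continuous f}.
    by apply: continuous_subspaceW cf; apply: subset_itvl; rewrite bnd_simp.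
  by have [c _ ->] := MVT_segment t1 dft cft; rewrite mul0r.
move=> t t1; rewrite -[LHS]/(f t) fcst// -(fcst 0) /f.
  by rewrite /= !fctE mulr0 cos0 sin0 mul1r mul0r addr0.
by rewrite lerN10 ler01.
Qed.
End complex_vector_limits.

(** * Solutions of u' = jw u on [-1, 1] *)

Section exponential_solutions.
Variable R : realType.

Lemma Re_scale (a : R) (z : R[i]) : complex.Re (a%:C * z) = a * complex.Re z.
Proof. by case: z => x y /=; rewrite mul0r subr0. Qed.

Lemma Im_scale (a : R) (z : R[i]) : complex.Im (a%:C * z) = a * complex.Im z.
Proof. by case: z => x y /=; rewrite mul0r addr0. Qed.

Lemma is_deriv_onP k (phi psi : R -> 'cV[R[i]^o]_k) : is_deriv_on phi psi <->
  forall t i, -1 <= t <= 1 ->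
    ((s - t)^-1 * (complex.Re (phi s i 0) - complex.Re (phi t i 0))
      @[s --> within `[-1, 1]%classic t^'] --> complex.Re (psi t i 0)) /\
    ((s - t)^-1 * (complex.Im (phi s i 0) - complex.Im (phi t i 0))
      @[s --> within `[-1, 1]%classic t^'] --> complex.Im (psi t i 0)).
Proof.
have slopeE t i :
    ((fun s => complex.Re ((((s - t)^-1)%:C *: (phi s - phi t)) i 0)) =
     (fun s => (s - t)^-1 * (complex.Re (phi s i 0) - complex.Re (phi t i 0)))) /\
    ((fun s => complex.Im ((((s - t)^-1)%:C *: (phi s - phi t)) i 0)) =
     (fun s => (s - t)^-1 * (complex.Im (phi s i 0) - complex.Im (phi t i 0)))).
  by split; apply/funext => s; rewrite !mxE ?Re_scale ?Im_scale raddfB.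
split=> [D t i t1|D t t1].
  have [<- <-] := slopeE t i.
  by have /cvg_complex_colP/(_ i) := D t t1.
apply/cvg_complex_colP => i; have [-> ->] := slopeE t i.
exact: D.
Qed.

Lemma is_derive_cis (w : R) (z : R[i]) (t : R) :
  is_derive t 1 (fun s => complex.Re (cis (w * s) * z))
    (complex.Re ((0 +i* w) * (cis (w * t) * z))) /\
  is_derive t 1 (fun s => complex.Im (cis (w * s) * z))
    (complex.Im ((0 +i* w) * (cis (w * t) * z))).
Proof.
case: z => a b; have dc := is_derive_cos_scale w t; have ds := is_derive_sin_scale w t.
split.
- rewrite [X in is_derive _ _ X](_ : _ =
    (a \*: (fun s => cos (w * s))) - (b \*: (fun s => sin (w * s)))); last first.
    by apply/funext => s; rewrite /= !fctE [cos _ * _]mulrC [sin _ * _]mulrC.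
  by apply: is_derive_eq; rewrite /GRing.scale /=; ring.
- rewrite [X in is_derive _ _ X](_ : _ =
    (b \*: (fun s => cos (w * s))) + (a \*: (fun s => sin (w * s)))); last first.
    by apply/funext => s; rewrite /= !fctE [cos _ * _]mulrC [sin _ * _]mulrC.
  by apply: is_derive_eq; rewrite /GRing.scale /=; ring.
Qed.

Lemma is_derive_continuous (f : R -> R) (t l : R) :
  is_derive t 1 f l -> {for t, continuous f}.
Proof.
by move=> [fd _]; apply: differentiable_continuous; exact/derivable1_diffP.
Qed.

Lemma inX_cis k (w : R) (v : 'cV[R[i]]_k) : inX (fun t => cis (w * t) *: v).
Proof.
apply: continuous_subspaceT => t; apply/cvg_complex_colP => i.
have [dR dI] := is_derive_cis w (v i 0) t.
split; under eq_fun do rewrite mxE; rewrite mxE.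
  exact: is_derive_continuous dR.
exact: is_derive_continuous dI.
Qed.

Lemma is_deriv_on_cis k (w : R) (v : 'cV[R[i]]_k) :
  is_deriv_on (fun t => cis (w * t) *: v) (fun t => (0 +i* w) *: (cis (w * t) *: v)).
Proof.
apply/is_deriv_onP => t i t1.
have [/is_derive_slopeP dR /is_derive_slopeP dI] := is_derive_cis w (v i 0) t.
split; under eq_fun do rewrite !mxE; rewrite !mxE.
  by apply: cvg_trans dR; apply: cvg_app; exact: cvg_within.
by apply: cvg_trans dI; apply: cvg_app; exact: cvg_within.
Qed.

(** Uniqueness for u' = jw u: both the real and the imaginary part of e^(-jwt) u(t) are constant. *)
Lemma deriv_on_cisE k (w : R) (u : R -> 'cV[R[i]]_k) :
  inX u -> is_deriv_on u (fun t => (0 +i* w) *: u t) ->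
  forall t : R, -1 <= t <= 1 -> u t = cis (w * t) *: u 0.
Proof.
move=> /subspace_continuousP cu /is_deriv_onP du.
have cRe i : {within `[-1, 1], continuous (fun t : R => complex.Re (u t i 0))}.
  by apply/subspace_continuousP => t /cu /cvg_complex_colP/(_ i)[].
have cIm i : {within `[-1, 1], continuous (fun t : R => complex.Im (u t i 0))}.
  by apply/subspace_continuousP => t /cu /cvg_complex_colP/(_ i)[].
have dRI (i : 'I_k) (t : R) : -1 < t < 1 ->
    is_derive t 1 (fun t => complex.Re (u t i 0)) (- (w * complex.Im (u t i 0))) /\
    is_derive t 1 (fun t => complex.Im (u t i 0)) (w * complex.Re (u t i 0)).
  move=> t1; have t1' : -1 <= t <= 1 by case/andP: t1 => /ltW -> /ltW ->.
  have [] := du t i t1'; rewrite !mxE => dR dI; split; apply/is_derive_slopeP.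
    have -> : - (w * complex.Im (u t i 0)) = complex.Re ((0 +i* w) * u t i 0).
      by case: (u t i 0) => x y /=; rewrite mul0r sub0r.
    by apply: cvg_trans dR; apply: cvg_app; exact: within_dnbhs_itv.
  have -> : w * complex.Re (u t i 0) = complex.Im ((0 +i* w) * u t i 0).
    by case: (u t i 0) => x y /=; rewrite mul0r add0r.
  by apply: cvg_trans dI; apply: cvg_app; exact: within_dnbhs_itv.
move=> t t1; apply/colP => i; rewrite mxE.
have rot1 := @rotation_constant R w _ _ (cRe i) (cIm i)
  (fun t t1 => (dRI i t t1).1) (fun t t1 => (dRI i t t1).2) t t1.
(* The imaginary part is the real part of the rotated solution -ju, whose components are Im u and
   -Re u. *)
have rot2 := @rotation_constant R w _ (fun t => - complex.Re (u t i 0)) (cIm i).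
have {}rot2 : cos (w * t) * complex.Im (u t i 0) +
    sin (w * t) * - complex.Re (u t i 0) = complex.Im (u 0 i 0).
  apply: rot2 => // [|s s1|s s1].
  - by move=> x; apply: continuousN; exact: cRe.
  - by rewrite mulrN opprK; exact: (dRI i s s1).2.
  - by rewrite -[w * _]opprK; apply: is_deriveN; exact: (dRI i s s1).1.
have cs := cos2Dsin2 (w * t).
case: (u 0 i 0) rot1 rot2 => p q /= <- <-.
case: (u t i 0) => x y; rewrite /cis; apply/eqP; rewrite eq_complex /=.
move: (cos (w * t)) (sin (w * t)) cs => c s cs.
apply/andP; split; apply/eqP.
  have -> : c * (c * x + s * y) - s * (c * y + s * - x) = (c ^+ 2 + s ^+ 2) * x by ring.
  by rewrite cs mul1r.
have -> : c * (c * y + s * - x) + s * (c * x + s * y) = (c ^+ 2 + s ^+ 2) * y by ring.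
by rewrite cs mul1r.
Qed.

End exponential_solutions.

(** * Levels of a function whose values come arbitrarily close to [d] *)

Section level_sets.
Variables (R : realType) (f : R -> R) (d : R).
Hypotheses (f0 : forall w, 0 <= f w) (d0 : 0 <= d).
Hypothesis f_infty : forall e, 0 < e ->
  exists2 w, 0 <= w & `|f w ^+ 2 - d ^+ 2| <= e.

(** If [f w >= x] at some point, then, as [f] also takes values at most [x] because [d < x], the
    intermediate value theorem for the square of [f] produces a point at level [x]. *)
Lemma lt_level (x : R) : continuous (fun w => f w ^+ 2) ->
  d < x -> (forall w, f w <> x) -> forall w, f w < x.
Proof.
move=> cf dx fx w; rewrite ltNge; apply/negP => xfw.
have x0 : 0 < x by rewrite (le_lt_trans d0).
(* Taking this gap as tolerance yields a point where the square of [f] is at most [x ^+ 2]. *)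
have e0 : 0 < x ^+ 2 - d ^+ 2 by rewrite subr_gt0 ltr_pXn2r// nnegrE ltW.
have [w1 _] := f_infty e0; rewrite ler_distl => /andP[_].
rewrite addrCA subrr addr0 => fw1.
have fw : x ^+ 2 <= f w ^+ 2 by rewrite ler_pXn2r// nnegrE ?(ltW x0).
have [c fc] : exists c, f c ^+ 2 = x ^+ 2.
  have [ww1|/ltW w1w] := leP w w1.
    have [||c _ <-] := @IVT R (fun w => f w ^+ 2) w w1 (x ^+ 2) ww1; last by exists c.
      exact: continuous_subspaceT.
    by rewrite ge_min fw1 orbT le_max fw.
  have [||c _ <-] := @IVT R (fun w => f w ^+ 2) w1 w (x ^+ 2) w1w; last by exists c.
    exact: continuous_subspaceT.
  by rewrite ge_min fw1 le_max fw orbT.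
by apply: (fx c); apply/eqP; rewrite -(@eqrXn2 _ 2)// ?ltW//; apply/eqP.
Qed.

Lemma le_upper_bound (r : R) : (forall w, f w <= r) -> d <= r.
Proof.
move=> fr; have r0 : 0 <= r by rewrite (le_trans (f0 0)).
rewrite -(@ler_pXn2r _ 2)// ?nnegrE//; apply/ler_addgt0Pr => e e0.
have [w _] := f_infty e0.
rewrite ler_distl => /andP[+ _]; rewrite lerBlDr => /le_trans; apply.
by rewrite lerD2r ler_pXn2r// nnegrE.
Qed.

End level_sets.

(** * Imaginary eigenvalues of the operator, and symmetry in the frequency *)

Section eigenvalue_correspondence.
Variable R : realType.
Variables (m n nu ny : nat) (A : 'I_m.+1 -> 'M[R]_n).
Variables (B : 'M[R]_(n, nu)) (C : 'M[R]_(ny, n)) (D : 'M[R]_(ny, nu)).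
Variables (tau : 'I_m.+1 -> R) (xi : R).

Lemma cis0 : cis 0 = 1 :> R[i].
Proof. by rewrite /cis cos0 sin0. Qed.

(** An eigenfunction is e^(jwt) times its value at 0, so the domain condition becomes a matrix
    equation for that value. The bound on the delays keeps every evaluation point inside [-1, 1]. *)
Lemma Lxi_imag_eigenvalueP (w : R) : (forall i, 0 <= tau i <= 1) ->
  Lxi_eigenvalue A B C D tau xi (0 +i* w) <->
  exists2 v : 'cV_(n + n), v != 0 &
    (0 +i* w) *: v = hamiltonian A B C D tau xi w *m v.
Proof.
move=> tau01.
have hamE (u : R -> 'cV[R[i]]_(n + n)) :
    (forall t : R, -1 <= t <= 1 -> u t = cis (w * t) *: u 0) ->
    cmx (M0 (A ord0) B C D xi) *m u 0
      + \sum_(i < m) (cmx (Mpos (A (lift ord0 i))) *m u (- tau (lift ord0 i))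
                      + cmx (Mneg (A (lift ord0 i))) *m u (tau (lift ord0 i)))
      + cmx (Npos B C D xi) *m u (- tau ord0)
      + cmx (Nneg B C D xi) *m u (tau ord0) =
    hamiltonian A B C D tau xi w *m u 0.
  move=> uE.
  have uP i : u (tau i) = cis (w * tau i) *: u 0.
    by apply: uE; have /andP[t0 ->] := tau01 i; rewrite (le_trans (lerN10 _)).
  have uN i : u (- tau i) = cis (w * - tau i) *: u 0.
    apply: uE; have /andP[t0 t1] := tau01 i.
    by rewrite lerNr opprK t1 (le_trans _ (@ler01 R))// oppr_le0.
  rewrite /hamiltonian !mulmxDl -!scalemxAl mulmx_suml uP uN -!scalemxAr.
  congr (_ + _ + _ + _); apply: eq_bigr => i _.
  by rewrite mulmxDl -!scalemxAl uP uN -!scalemxAr.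
split=> [[u [[t t1 ut0] [cu _ du u0]]]|[v v0 vH]].
  have uE := deriv_on_cisE cu du.
  exists (u 0); first by apply: contra_neq ut0 => u00; rewrite (uE _ t1) u00 scaler0.
  by rewrite u0 hamE.
have uE (t : R) : -1 <= t <= 1 -> cis (w * t) *: v = cis (w * t) *: (cis (w * 0) *: v).
  by rewrite mulr0 cis0 scale1r.
exists (fun t => cis (w * t) *: v); split.
  by exists 0; rewrite ?lerN10 ?ler01// mulr0 cis0 scale1r.
split.
- exact: inX_cis.
- rewrite (_ : (fun t => _) = fun t => cis (w * t) *: ((0 +i* w) *: v)).
    exact: inX_cis.
  by apply/funext => t; rewrite !scalerA mulrC.
- exact: is_deriv_on_cis.
- by rewrite (hamE (fun t => cis (w * t) *: v) uE) mulr0 cis0 scale1r.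
Qed.

(** A kernel vector of [Dxi D xi] is an eigenvector of D^T D for xi^2. A nonnegative [xi] would then
    be a singular value of [D], hence at most [sigma1]; a negative one is below it anyway. *)
Lemma Dxi_unitmx : (0 < nu)%N -> sigma1 (cmx D) < xi -> Dxi D xi \in unitmx.
Proof.
move=> nu0 Dx; rewrite unitmxE unitfE; apply: contraTN Dx => /det0P[v v0 vD].
rewrite -leNgt; have [[s0 _] _] := sigma1P (cmx D) nu0.
have [x0|x0] := ltP xi 0; first by rewrite (le_trans (ltW x0)).
apply: singular_value_le_sigma1 => //; split=> //.
apply/eigenvalueP; exists (cmx v).
  rewrite cmx_adjoint -!cmxM.
  move/eqP: vD; rewrite mulmxBr subr_eq0 mul_mx_scalar => /eqP ->.
  by apply/matrixP => i j; rewrite !mxE rmorphM.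
by rewrite cmxE map_mx_eq0.
Qed.

(** Conjugating an eigenvector of the Gram matrix preserves its real eigenvalue, which gives one
    inequality; the other follows since conjugation is an involution. *)
Lemma sigma1_conj p q (M : 'M[R[i]]_(p, q)) : (0 < q)%N ->
  sigma1 (map_mx Num.conj M) = sigma1 M.
Proof.
move=> q0.
have eigC (N : 'M[R[i]]_(p, q)) s :
    singular_value N s -> singular_value (map_mx Num.conj N) s.
  move=> [s0 /eigenvalueP[v Nv v0]]; split=> //.
  apply/eigenvalueP; exists (map_mx Num.conj v); last by rewrite map_mx_eq0.
  have -> : (map_mx Num.conj N)^t* *m map_mx Num.conj N =
      map_mx Num.conj (N^t* *m N) by rewrite map_mxM map_trmx.
  rewrite -[LHS]map_mxM Nv; apply/matrixP => i j.
  rewrite !mxE rmorphM; congr (_ * _).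
  by rewrite /= conj_Creal// complex_real.
have leC (N : 'M[R[i]]_(p, q)) : sigma1 N <= sigma1 (map_mx Num.conj N).
  by apply: singular_value_le_sigma1 => //; apply: eigC; have [] := sigma1P N q0.
have MK : map_mx Num.conj (map_mx Num.conj M) = M.
  by apply/matrixP => i j; rewrite !mxE conjCK.
have leM := leC (map_mx Num.conj M); rewrite MK in leM.
by apply: le_anti; apply/andP; split; [exact: leM | exact: leC].
Qed.

Lemma transferN w : transfer A B C D tau (0 +i* - w) =
  map_mx Num.conj (transfer A B C D tau (0 +i* w)).
Proof.
have cmxC p q (M : 'M[R]_(p, q)) : map_mx Num.conj (cmx M) = cmx M.
  by apply/matrixP => i j; rewrite !mxE conj_Creal// complex_real.
have cexpC t : cexp (- (0 +i* - w) * t%:C) = Num.conj (cexp (- (0 +i* w) * t%:C)).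
  by rewrite !cexp_cis conj_cis mulNr mulrN.
have charC : map_mx Num.conj (charmx A tau (0 +i* w)) = charmx A tau (0 +i* - w).
  rewrite /charmx !map_mxB cmxC map_scalar_mx map_mx_sum.
  rewrite [X in _ - X](_ : _ = \sum_(i < m)
      cexp (- (0 +i* - w) * (tau (lift ord0 i))%:C) *: cmx (A (lift ord0 i))) //.
  by apply: eq_bigr => i _; rewrite map_mxZ cmxC cexpC.
by rewrite /transfer map_mxD map_mxZ !map_mxM map_invmx !cmxC cexpC charC.
Qed.

(** The norm is a supremum over nonnegative frequencies, whereas eigenvalues are excluded on the
    whole imaginary axis; this symmetry, due to real data, bridges the two. *)
Lemma sigma1_transfer_norm w : (0 < nu)%N ->
  sigma1 (transfer A B C D tau (0 +i* w)) =
  sigma1 (transfer A B C D tau (0 +i* `|w|)).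
Proof.
move=> nu0; have [//|w0] := ger0P w; rewrite -[in LHS](opprK w) transferN.
exact: sigma1_conj.
Qed.

End eigenvalue_correspondence.

Theorem corollary2p4 (R : realType) (m n nu ny : nat)
    (A : 'I_m.+1 -> 'M[R]_n) (B : 'M[R]_(n, nu)) (C : 'M[R]_(ny, n))
    (D : 'M[R]_(ny, nu)) (tau : 'I_m.+1 -> R)
    (n_gt0 : (0 < n)%N) (nu_gt0 : (0 < nu)%N) (ny_gt0 : (0 < ny)%N)
    (tau_ge0 : forall i, 0 <= tau i)
    (tau_max : \big[Num.max/0]_(i < m.+1) tau i = 1)
    (stableG : stable A tau) :
  hinf_norm A B C D tau =
  ereal_inf [set xi%:E | xi in [set xi : R | sigma1 (cmx D) < xi /\
    (forall lam : R[i], Lxi_eigenvalue A B C D tau xi lam -> complex.Re lam <> 0)]].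
Proof.
have tau01 i : 0 <= tau i <= 1.
  by rewrite tau_ge0/= -tau_max (le_bigmax_cond 0 (P := xpredT)).
pose G w := transfer A B C D tau (0 +i* w).
have sigD0 : 0 <= sigma1 (cmx D) by have [[]] := sigma1P (cmx D) nu_gt0.
have sigG0 w : 0 <= sigma1 (G w) by have [[]] := sigma1P (G w) nu_gt0.
have G_infty := sigma1_sq_transfer_infinity B C D nu_gt0 stableG.
set T := [set _ | _ in _].
(* For a bound [r] over all frequencies, each [r + e] belongs to the set: it exceeds
   [sigma1 (cmx D)], and an imaginary eigenvalue would make it a singular value of some [G w], above
   [r]. *)
have le_inf (r : R) : (forall w, sigma1 (G w) <= r) -> (ereal_inf T <= r%:E)%E.
  move=> Gr; have Dr := le_upper_bound sigG0 sigD0 G_infty Gr.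
  apply/lee_addgt0Pr => e e0; rewrite -EFinD.
  have re : r < r + e by rewrite ltrDl.
  have Dre := le_lt_trans Dr re.
  apply: ereal_inf_lbound; exists (r + e) => //; split; first exact: Dre.
  move=> [a w] eig /= a0; rewrite {a}a0 in eig.
  have /(hamiltonian_eigenP _ _ _ stableG (Dxi_unitmx nu_gt0 Dre)) eigw :=
    (Lxi_imag_eigenvalueP A B C D (r + e) w tau01).1 eig.
  have reG : r + e <= sigma1 (G w).
    apply: singular_value_le_sigma1 nu_gt0 _; split; last exact: eigw.
    by rewrite (le_trans sigD0 (ltW Dre)).
  by have := lt_le_trans re (le_trans reG (Gr w)); rewrite ltxx.
apply/eqP; rewrite eq_le; apply/andP; split.
  (* An admissible [xi] is never equal to [sigma1 (G c)], since it would then give the eigenvalue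
     jc; by [lt_level] it exceeds the whole frequency response. *)
  apply: le_ereal_inf_tmp => _ [xi [Dxi noeig] <-].
  apply: ge_ereal_sup => _ [w w0 <-]; rewrite lee_fin; apply/ltW.
  apply: (lt_level sigG0 sigD0 G_infty _ Dxi) => [|c Gc].
    exact: sigma1_sq_transfer_continuous.
  have [[_ eigc] _] := sigma1P (G c) nu_gt0.
  rewrite Gc in eigc.
  apply: (noeig (0 +i* c)) => //.
  apply/(Lxi_imag_eigenvalueP _ _ _ _ _ _ tau01).
  by apply/(hamiltonian_eigenP _ _ _ stableG (Dxi_unitmx nu_gt0 Dxi)).
have ubG w : 0 <= w -> ((sigma1 (G w))%:E <= hinf_norm A B C D tau)%E.
  by move=> w0; apply: ereal_sup_ubound; exists w.
(* A finite norm bounds all frequencies by symmetry, an infinite one needs nothing, and minus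
   infinity is excluded by the value at frequency 0. *)
case: (hinf_norm A B C D tau) ubG => [r| |] ubG.
- apply: le_inf => w; rewrite /G sigma1_transfer_norm// -lee_fin; exact: ubG.
- exact: leey.
- by have := ubG 0 (lexx _); rewrite leeNy_eq.
Qed.
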